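(* Let $0<q\le 2$ be fixed, let $\mathbf{B}\in\mathbb{C}^{m\times N}$, and let $\{\mathbf{B}^{\delta_j}\}_{j\in\mathbb{N}}\subset\mathbb{C}^{m\times N}$ be a sequence such that $\|\mathbf{B}-\mathbf{B}^{\delta_j}\|_F\le\delta_j$ for all $j\in\mathbb{N}$, where $\delta_j\to0$ as $j\to\infty$. Let $\{\gamma_j\}_{j\in\mathbb{N}}$ be a sequence of positive real numbers such that $$\gamma_j\to0\quad\text{and}\quad\frac{\delta_j^2}{\gamma_j}\to0\quad\text{as } j\to\infty.$$ With $\mathbf{M}$ the FDEM forward operator, $\mathbf{D}$ the discrete Laplacian and $\iota_0$ the indicator function of the non-negative cone (all defined in the context), let $$\mathcal{J}_j(\mathbf{\Sigma})=\frac12\|\mathbf{M}(\mathbf{\Sigma})-\mathbf{B}^{\delta_j}\|_F^2+\frac{\gamma_j}{q}\|\mathbf{D}(\mathbf{\Sigma})\|_q^q+\iota_0(\mathbf{\Sigma}),\qquad \mathbf{\Sigma}\in\mathbb{R}^{n\times N},$$ and, for every $j\in\mathbb{N}$, let $\mathbf{\Sigma}_j\in\arg\min_{\mathbf{\Sigma}}\mathcal{J}_j(\mathbf{\Sigma})$ be a global minimizer. Assume that the set $$\arg\min\{\|\mathbf{D}(\mathbf{\Sigma})\|_q^q:\ \mathbf{M}(\mathbf{\Sigma})=\mathbf{B},\ \mathbf{\Sigma}\ge0\}$$ is not empty. Then there exists a convergent subsequence $\{\mathbf{\Sigma}_{j_k}\}$ of $\{\mathbf{\Sigma}_j\}_{j\in\mathbb{N}}$,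 with $\mathbf{\Sigma}_{j_k}\to\mathbf{\Sigma}^*$ as $j_k\to\infty$, such that $$\mathbf{\Sigma}^*\in\arg\min\{\|\mathbf{D}(\mathbf{\Sigma})\|_q^q:\ \mathbf{M}(\mathbf{\Sigma})=\mathbf{B},\ \mathbf{\Sigma}\ge0\}.$$
   Context: Norms. $\|\cdot\|_F$ is the Frobenius norm. For $q>0$ and a real vector $\mathbf{x}$, $\|\mathbf{x}\|_q^q=\sum_i|x_i|^q$ (for $0<q<1$ this does not come from a norm). $\mathbf{\Sigma}\ge0$ means that all entries are non-negative; $\iota_0(\mathbf{\Sigma})=0$ if $\mathbf{\Sigma}\ge0$ and $\iota_0(\mathbf{\Sigma})=+\infty$ otherwise (so functionals containing $\iota_0$ take the value $+\infty$ off the non-negative cone, and only the values of $\mathbf{M}$ on the cone matter). Discrete Laplacian. For $\mathbf{\Sigma}\in\mathbb{R}^{n\times N}$, $\mathbf{D}(\mathbf{\Sigma})=D\,\mathrm{vec}(\mathbf{\Sigma})\in\mathbb{R}^{nN}$, where $\mathrm{vec}$ stacks columns and $D=L_N\otimes I_n+I_N\otimes L_n$, with $\otimes$ the Kronecker product, $I_k$ the $k\times k$ identity, and $L_k$ the $k\times k$ tridiagonal matrix with $2$ on the diagonal and $-1$ on the sub- and superdiagonal (zero boundary conditions). Forward operator. The soil has $n$ layers. Layer $i$ has conductivity $\sigma_i$, magnetic permeability $\mu_i=\mu_0:=4\pi\cdot10^{-7}$ (known and constant), and thickness $d_i>0$, with $d_n=\infty$. For conductivities $\boldsymbol{\sigma}=(\sigma_1,\dots,\sigma_n)^T$,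 angular frequency $\omega>0$ and $\lambda>0$, put $u_i(\lambda)=\sqrt{\lambda^2+\mathrm{i}\sigma_i\mu_i\omega}$ with $\mathrm{Re}(u_i(\lambda))\ge0$, $N_i(\lambda)=u_i(\lambda)/(\mathrm{i}\mu_i\omega)$, $N_0(\lambda)=\lambda/(\mathrm{i}\mu_0\omega)$. The surface admittances are $Y_n(\lambda)=N_n(\lambda)$ and, for $i=n-1,\dots,1$, $$Y_i(\lambda)=N_i(\lambda)\frac{Y_{i+1}(\lambda)+N_i(\lambda)\tanh(d_iu_i(\lambda))}{N_i(\lambda)+Y_{i+1}(\lambda)\tanh(d_iu_i(\lambda))}.$$ The reflection factor is $R_{\omega,0}(\lambda)=\dfrac{N_0(\lambda)-Y_1(\lambda)}{N_0(\lambda)+Y_1(\lambda)}$. For coil orientation $\nu\in\{0,1\}$ (vertical/horizontal), instrument height $h>0$ and inter-coil distance $\rho>0$, $$M_\nu(\boldsymbol{\sigma};h,\omega,\rho)=-\rho^{3-\nu}\int_0^\infty\lambda^{1-\nu}e^{-2h\lambda}R_{\omega,0}(\lambda)J_\nu(\rho\lambda)\lambda\,d\lambda,$$ where $J_0,J_1$ are the Bessel functions of the first kind of orders $0,1$. Fix finitely many inter-coil distances $\rho_1,\dots,\rho_{m_\rho}$, heights $h_1,\dots,h_{m_h}$ and angular frequencies $\omega_1,\dots,\omega_{m_\omega}$, and let $m=2m_\rho m_hm_\omega$. Then $M(\boldsymbol{\sigma})\in\mathbb{C}^m$ is the vector collecting, in a fixed order, all values $M_\nu(\boldsymbol{\sigma};h_l,\omega_s,\rho_t)$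 for $\nu\in\{0,1\}$, $1\le t\le m_\rho$, $1\le l\le m_h$, $1\le s\le m_\omega$. For $\mathbf{\Sigma}=[\boldsymbol{\sigma}_1,\dots,\boldsymbol{\sigma}_N]\in\mathbb{R}^{n\times N}$, $\mathbf{M}(\mathbf{\Sigma})=[M(\boldsymbol{\sigma}_1),\dots,M(\boldsymbol{\sigma}_N)]\in\mathbb{C}^{m\times N}$. *)

(* Defs.v *)
From HB Require Import structures.
From mathcomp Require Export all_boot all_order all_algebra.
From mathcomp Require Export all_classical all_reals all_analysis.
From mathcomp Require Export complex mxtens.

Set Implicit Arguments.
Unset Strict Implicit.
Unset Printing Implicit Defensive.

Export Order.TTheory GRing.Theory Num.Theory.
Export numFieldNormedType.Exports.

Local Open Scope classical_set_scope.
Local Open Scope ring_scope.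
Local Open Scope complex_scope.

Definition argmin {T : Type} {disp : Order.disp_t} {U : porderType disp}
    (A : set T) (f : T -> U) : set T :=
  [set x | A x /\ forall y, A y -> (f x <= f y)%O].

Definition frobenius {R : realType} {m N : nat} (A : 'M[R[i]]_(m, N)) : R :=
  Num.sqrt (\sum_i \sum_j Normc.normc (A i j) ^+ 2).

Definition lq_pow {R : realType} {k : nat} (q : R) (x : 'cV[R]_k) : R :=
  \sum_i `|x i 0| `^ q.

Definition iota0 {R : realType} {n N : nat} (S : 'M[R]_(n, N)) : \bar R :=
  if S \is a mxOver Num.nneg then 0%E else +oo%E.

(* Column stacking: mxtens_unindex k = (k %/ n, k %% n), so entry j * n + i is
   S i j, in agreement with the block structure of the Kronecker product *t. *)
Definition vec {R : realType} {n N : nat} (S : 'M[R]_(n, N)) : 'cV[R]_(N * n) :=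
  \col_k S (mxtens_unindex k).2 (mxtens_unindex k).1.

Definition lap1 (R : realType) (k : nat) : 'M[R]_k :=
  \matrix_(i, j) (if i == j then 2
                  else if (i == j.+1 :> nat) || (j == i.+1 :> nat) then -1
                  else 0).

Definition laplacian {R : realType} {n N : nat} (S : 'M[R]_(n, N)) :
    'cV[R]_(N * n) :=
  (lap1 R N *t 1%:M + 1%:M *t lap1 R n) *m vec S.

Definition cexp {R : realType} (z : R[i]) : R[i] :=
  (expR (complex.Re z))%:C * (cos (complex.Im z) +i* sin (complex.Im z)).

Definition ctanh {R : realType} (z : R[i]) : R[i] :=
  (cexp z - cexp (- z)) / (cexp z + cexp (- z)).

Definition cintegral {R : realType} (D : set R) (f : R -> R[i]) : R[i] :=
  (\int[lebesgue_measure]_(x in D) complex.Re (f x)) +i*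
  (\int[lebesgue_measure]_(x in D) complex.Im (f x)).

Definition besselJ {R : realType} (nu : nat) (x : R) : R :=
  limn (series (fun k : nat =>
    (-1) ^+ k / (k`! * (k + nu)`!)%:R * (x / 2) ^+ (2 * k + nu))).

Definition mu0 (R : realType) : R := 4 * pi * 10 ^- 7.

(* sqrtc is the principal square root: its real part is non-negative. *)
Definition wavenumber {R : realType} (omega lambda sigma : R) : R[i] :=
  sqrtc (lambda ^+ 2 +i* (sigma * mu0 R * omega)).

Definition layerN {R : realType} (omega lambda sigma : R) : R[i] :=
  wavenumber omega lambda sigma / ((mu0 R * omega) *i).

Definition airN {R : realType} (omega lambda : R) : R[i] :=
  lambda%:C / ((mu0 R * omega) *i).

(* Surface admittance of a stack of n.+1 layers listed from the top, the last
   one being a half-space, so that only n thicknesses occur.  Since Y_i depends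
   only on the layers from i downwards, Y_(i+1) is the surface admittance of
   the stack with its top layer removed. *)
Fixpoint admittance {R : realType} (omega lambda : R) (n : nat) :
    ('I_n.+1 -> R) -> ('I_n -> R) -> R[i] :=
  match n with
  | 0 => fun sigma _ => layerN omega lambda (sigma ord0)
  | n'.+1 => fun sigma d =>
      let N1 := layerN omega lambda (sigma ord0) in
      let Y2 := admittance omega lambda (fun k => sigma (lift ord0 k))
                                        (fun k => d (lift ord0 k)) in
      let t := ctanh ((d ord0)%:C * wavenumber omega lambda (sigma ord0)) in
      N1 * ((Y2 + N1 * t) / (N1 + Y2 * t))
  end.

Definition reflection {R : realType} (n : nat) (d : 'I_n -> R)
    (sigma : 'I_n.+1 -> R) (omega lambda : R) : R[i] :=
  let N0 := airN omega lambda in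
  let Y1 := admittance omega lambda sigma d in
  (N0 - Y1) / (N0 + Y1).

Definition fdem {R : realType} (n : nat) (d : 'I_n -> R) (nu : nat)
    (sigma : 'I_n.+1 -> R) (h omega rho : R) : R[i] :=
  - (rho ^+ (3 - nu))%:C *
  cintegral `[0, +oo[ (fun lambda : R =>
    (lambda ^+ (1 - nu) * expR (- 2 * h * lambda))%:C *
    reflection d sigma omega lambda *
    (besselJ nu (rho * lambda) * lambda)%:C).

(* The bijection e is the order in which the measurements are listed: the k-th
   one has orientation nu, distance rho t, height h l and frequency omega s,
   where e k = (nu, t, l, s). *)
Definition forward {R : realType} (n N mrho mh momega : nat) (d : 'I_n -> R)
    (rho : 'I_mrho -> R) (h : 'I_mh -> R) (omega : 'I_momega -> R)
    (e : 'I_(2 * mrho * mh * momega) -> 'I_2 * 'I_mrho * 'I_mh * 'I_momega)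
    (S : 'M[R]_(n.+1, N)) : 'M[R[i]]_(2 * mrho * mh * momega, N) :=
  \matrix_(k, j)
    (let: (nu, t, l, s) := e k in
     fdem d nu (fun i => S i j) (h l) (omega s) (rho t)).

Definition objective {R : realType} (n N m : nat)
    (M : 'M[R]_(n, N) -> 'M[R[i]]_(m, N)) (q gamma : R) (B : 'M[R[i]]_(m, N))
    (S : 'M[R]_(n, N)) : \bar R :=
  ((2^-1 * frobenius (M S - B) ^+ 2 + gamma / q * lq_pow q (laplacian S))%:E
   + iota0 S)%E.

Definition exact_solutions {R : realType} (n N m : nat)
    (M : 'M[R]_(n, N) -> 'M[R[i]]_(m, N)) (q : R) (B : 'M[R[i]]_(m, N)) :
    set 'M[R]_(n, N) :=
  argmin [set S | M S = B /\ S \is a mxOver Num.nneg]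
         (fun S => lq_pow q (laplacian S)).

(* Main.v *)
Require Import Defs.
From mathcomp Require Import measurable_realfun zify ring lra.

(** The outer argument is that of Tikhonov regularization.  Comparing Sigma_j with
    an exact solution of minimal penalty L gives
      |M(Sigma_j) - B^delta_j|^2 / 2 + (gamma_j / q) |D Sigma_j|_q^q
        <= delta_j^2 / 2 + (gamma_j / q) L.
    Dividing by gamma_j / q, the penalties of the Sigma_j are at most L + o(1);
    letting gamma_j tend to 0, the misfits tend to 0.  The Laplacian is invertible
    ([laplacian_mx_unit], by a discrete maximum principle), so the Sigma_j are
    bounded and a subsequence converges.  Its limit is non-negative, has penalty
    at most L by continuity of the penalty, and is mapped to B provided that the
    forward operator is continuous on the non-negative cone
    ([tikhonov_stability]).

    That continuity ([fdem_cvg]) is the substance of the proof.  It follows by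
    dominated convergence in the Hankel integral from three facts.

    First, after multiplication by i mu0 omega, every surface admittance lies in
    the quadrant Re > 0, Im >= 0 ([layer_step_quadrant]).  This is the discrete
    trace of a flow: in a homogeneous layer, moving upwards, the scaled admittance
    v obeys the Riccati equation v' = u^2 - v^2, and as Re (u^2) = lambda^2 > 0
    and Im (u^2) >= 0 the field points into the quadrant along its boundary.  The
    proof works on the closed formula of one step instead.  Consequently no
    denominator of the recursion vanishes, and the reflection factor
    (lambda - v) / (lambda + v) has modulus at most one.

    Secondly, the reflection factor is continuous in the conductivities and in
    lambda ([ccvg_reflection]).

    Thirdly, J_0^2 + J_1^2 <= 1 ([clifford_energy_le1]), because this energy equals
    1 at the origin and decreases.  The power series defining the Bessel functions
    only gives a bound growing exponentially in rho lambda, which the factor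
    e^(- 2 h lambda) need not compensate. *)

Set Implicit Arguments.
Unset Strict Implicit.
Unset Printing Implicit Defensive.

Local Open Scope classical_set_scope.
Local Open Scope ring_scope.

(** * Elementary inequalities for hyperbolic and circular functions *)

Lemma ge0_ndecr (R : realType) (f f' : R -> R) :
  (forall x : R, is_derive x (1:R) f (f' x)) -> (forall x, 0 < x -> 0 <= f' x) ->
  forall x, 0 <= x -> f 0 <= f x.
Proof.
move=> df f'0 x x0.
apply: (@ger0_derive1_le_cc R f 0 x) => //; rewrite ?in_itv /= ?lexx ?x0 //.
- move=> y; rewrite in_itv/= => /andP[y0 _].
  by rewrite derive1E; have := df y => -[_ ->]; exact: f'0.
- apply: continuous_subspaceT => y; apply: differentiable_continuous.
  by apply/derivable1_diffP; have := df y => -[].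
Qed.

Section trig.
Context {R : realType}.

Definition ch (x : R) := (expR x + expR (- x)) / 2.
Definition sh (x : R) := (expR x - expR (- x)) / 2.

Lemma ch_ge1 x : 1 <= ch x.
Proof.
have := @expR_ge1Dx R x; have := @expR_ge1Dx R (-x).
by rewrite /ch; lra.
Qed.

Lemma ch2sh2 x : ch x ^+ 2 - sh x ^+ 2 = 1.
Proof. by rewrite -[RHS](@expRxMexpNx_1 R x) /ch /sh; field. Qed.

Lemma sh_ge x : 0 <= x -> x <= sh x.
Proof.
move=> x0; rewrite -subr_ge0.
have -> : 0 = sh 0 - 0 by rewrite /sh oppr0 subrr mul0r addr0.
apply: (@ge0_ndecr R (fun y => sh y - y) (fun y => ch y - 1)) => //.
- move=> y.
  have dN : is_derive y (1:R) (fun z : R => expR (- z)) (- expR (- y)).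
    by apply: is_derive_eq; rewrite /GRing.scale /= mulrN1.
  rewrite (_ : (fun z => sh z - z) =
    (2^-1 \*: ((@expR R) - (fun z : R => expR (- z))) - id)); last first.
    by apply/funext => z; rewrite /sh !fctE /GRing.scale /= mulrC.
  by apply: is_derive_eq; rewrite /ch /GRing.scale /= opprK mulrC.
- by move=> y _; rewrite subr_ge0 ch_ge1.
Qed.

Lemma sin_norm_le (x : R) : 0 <= x -> `|sin x| <= x.
Proof.
move=> x0; rewrite ler_norml -subr_ge0 -[X in _ && X]subr_ge0.
apply/andP; split.
  have -> : 0 = sin 0 - - 0 :> R by rewrite sin0 oppr0 subrr.
  apply: (@ge0_ndecr R (fun y => sin y - - y) (fun y => cos y + 1)) => //.
  by move=> y; apply: is_derive_eq; rewrite opprK.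
rewrite (_ : 0 = 0 - sin 0 :> R); last by rewrite sin0 subrr.
apply: (@ge0_ndecr R (fun y => y - sin y) (fun y => 1 - cos y)) => //.
Qed.

End trig.

(** * Complex exponentials and division in coordinates *)

Section complex_trig.
Context {R : realType}.
Local Open Scope complex_scope.
Implicit Types u v z : R[i].

Lemma cexp2 z (a := complex.Re z) (b := complex.Im z) :
  (cexp z + cexp (- z) = 2%:C * (ch a * cos b +i* (sh a * sin b))) *
  (cexp z - cexp (- z) = 2%:C * (sh a * cos b +i* (ch a * sin b))).
Proof.
rewrite /a /b => {a b}; case: z => a' b' /=; rewrite /cexp /= cosN sinN.
by split; simpc; congr (_ +i* _); rewrite /ch /sh; field.
Qed.

(** With z = a + i b, the hyperbolic sine and cosine of z are
    sinh a cos b + i cosh a sin b and cosh a cos b + i sinh a sin b. *)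
Lemma ctanhE z (a := complex.Re z) (b := complex.Im z) :
  ctanh z = (sh a * cos b +i* (ch a * sin b)) / (ch a * cos b +i* (sh a * sin b)).
Proof.
have n2 : 2%:C != 0 :> R[i] by rewrite eq_complex /= eqxx andbT pnatr_eq0.
by rewrite /ctanh !cexp2 -/a -/b invfM mulrACA divff // mul1r.
Qed.

Lemma complex_divE z u : let n := complex.Re u ^+ 2 + complex.Im u ^+ 2 in
  z / u = (complex.Re (z * u^*%C) / n) +i* (complex.Im (z * u^*%C) / n).
Proof. by case: z u => [a b] [c d] /=; simpc; congr (_ +i* _); ring. Qed.

End complex_trig.

(** * One layer preserves a quadrant of admittances *)

Section wave.
Context {R : realType}.
Local Open Scope complex_scope.
Implicit Types (u v z : R[i]) (d lam om s : R).

(** Admittances multiplied by i mu0 omega live here.  The first inequality makes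
    reflection factors have modulus at most one; the second is what makes the
    first propagate from one layer to the next. *)
Definition quadrant z := (0 < complex.Re z) && (0 <= complex.Im z).

Lemma mu0_gt0 : 0 < mu0 R.
Proof. by rewrite /mu0 !mulr_gt0 ?pi_gt0 ?invr_gt0 ?exprn_gt0. Qed.

(** A non-negative conductivity puts the radicand in the closed upper half-plane,
    where the sign in the principal square root is constant; hence the root is
    given by one continuous formula. *)
Lemma wavenumberE om lam s (c := s * mu0 R * om)
    (r := Num.sqrt (lam ^+ 2 ^+ 2 + c ^+ 2)) : 0 <= om -> 0 <= s ->
  wavenumber om lam s =
    Num.sqrt ((r + lam ^+ 2) / 2) +i* Num.sqrt ((r - lam ^+ 2) / 2).
Proof.
move=> om0 s0; have c0 : 0 <= c
  by apply: mulr_ge0 => //; apply: mulr_ge0 => //; exact/ltW/mu0_gt0.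
rewrite /wavenumber /sqrtc -/c -/r; congr (_ +i* _).
case: eqVneq => [_|cn0]; first by rewrite mul1r.
by rewrite gtr0_sg ?mul1r // lt_def cn0.
Qed.

(** The square of the wave number is lambda^2 + i c with c >= 0; its real part
    a^2 - b^2 being positive, the root a + i b has b <= a. *)
Lemma wavenumber_quadrant om lam s : 0 < om -> 0 < lam -> 0 <= s ->
  quadrant (wavenumber om lam s) /\
  complex.Im (wavenumber om lam s) <= complex.Re (wavenumber om lam s).
Proof.
move=> om0 lam0 s0; rewrite wavenumberE ?(ltW om0) // /quadrant /=.
set r := Num.sqrt (_ + _).
have l2 : 0 < lam ^+ 2 by rewrite exprn_gt0.
have r0 : 0 <= r by rewrite sqrtr_ge0.
rewrite sqrtr_gt0 sqrtr_ge0 divr_gt0 ?ltr_wpDl //; split => //.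
by rewrite ler_wsqrtr // ler_pM2r ?invr_gt0 // lerD2l; lra.
Qed.

(** The admittance recursion is homogeneous of degree one in (N_i, Y_(i+1)):
    multiplying both by i mu0 omega turns N_i into the wave number u and Y_(i+1)
    into v. *)
Definition layer_step d u v : R[i] :=
  let t := ctanh (d%:C * u) in u * ((v + u * t) / (u + v * t)).

(** Since tanh (d u) = S / C, the new admittance is u (v C + u S) / (u C + v S),
    and its real and imaginary parts have the signs of those of the numerator
    times the conjugate denominator.  Expanded, this product is a combination of
    v, u and u^2 with coefficients |C|^2, |S|^2 and S C^*, all explicit when C
    and S are the hyperbolic cosine and sine of d u. *)
Lemma layer_step_identity u v C S :
  (complex.Re (u * (v * C + u * S) * (u * C + v * S)^*%C) =
   (complex.Re u ^+ 2 + complex.Im u ^+ 2) *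
     (complex.Re v * (complex.Re C ^+ 2 + complex.Im C ^+ 2) + complex.Re (u * (S * C^*%C))) +
   (complex.Re v ^+ 2 + complex.Im v ^+ 2) * complex.Re (u * (S * C^*%C)^*%C) +
   (complex.Re S ^+ 2 + complex.Im S ^+ 2) * complex.Re (u ^+ 2 * v^*%C)) *
  (complex.Im (u * (v * C + u * S) * (u * C + v * S)^*%C) =
   (complex.Re u ^+ 2 + complex.Im u ^+ 2) *
     (complex.Im v * (complex.Re C ^+ 2 + complex.Im C ^+ 2) + complex.Im (u * (S * C^*%C))) +
   (complex.Re v ^+ 2 + complex.Im v ^+ 2) * complex.Im (u * (S * C^*%C)^*%C) +
   (complex.Re S ^+ 2 + complex.Im S ^+ 2) * complex.Im (u ^+ 2 * v^*%C)).
Proof.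
by case: u v C S => [a b] [x y] [c1 c2] [s1 s2] /=; split; simpc; ring.
Qed.

Lemma quadrant_neq0 z : quadrant z -> z != 0.
Proof.
by case: z => a b /andP[/= a0 _]; rewrite eq_complex /= gt_eqF.
Qed.

(** Write u = a + i b with 0 <= b <= a, so that S C^* = sinh (da) cosh (da) +
    i sin (db) cos (db).  From sinh t >= t, cosh t >= 1 and |sin t| <= t, the
    real part of S C^* is at least d a and its imaginary part at most d b in
    absolute value, so every bracket of [layer_step_identity] in which these
    compete has the right sign.  The remaining term of indefinite sign,
    - |S|^2 Re (u^2) Im v, is absorbed by |u|^2 |C|^2 Im v.  Strict positivity of
    the real part also shows that the denominator does not vanish. *)
Lemma layer_step_quadrant d u v : 0 < d ->
    quadrant u -> complex.Im u <= complex.Re u -> quadrant v ->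
  let t := ctanh (d%:C * u) in u + v * t != 0 /\ quadrant (layer_step d u v).
Proof.
move=> d0 qu leba qv.
case: (u) (v) qu leba qv => [a b] [x y] /andP[/= a0 b0] leba /andP[/= x0 y0].
rewrite /layer_step; set u' := a +i* b; set v' := x +i* y.
rewrite (_ : d%:C * u' = (d * a) +i* (d * b)); last by rewrite /u'; simpc.
rewrite ctanhE /=.
set p := sh (d * a); set c := ch (d * a); set k := cos (d * b); set s := sin (d * b).
set S := p * k +i* _; set C := c * k +i* _.
have pa : d * a <= p by apply: sh_ge; rewrite mulr_ge0 // ltW.
have da : 0 < d * a by rewrite mulr_gt0.
have p0 : 0 < p by apply: lt_le_trans pa.
have c1 : 1 <= c by apply: ch_ge1.
have cp : c ^+ 2 = p ^+ 2 + 1 by have := ch2sh2 (d * a); rewrite -/c -/p; lra.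
have ks : k ^+ 2 = 1 - s ^+ 2 by rewrite -cos2sin2.
have k1 : `|k| <= 1 by apply: cos_max.
have sb : `|s| <= d * b by apply: sin_norm_le; rewrite mulr_ge0 // ltW.
clearbody p c k s.
have skb : `|s * k| <= d * b.
  by rewrite normrM (le_trans _ sb) // ler_piMr.
have pca : d * a <= p * c by rewrite (le_trans pa) // ler_peMr // ltW.
have SC : S * C^*%C = (p * c) +i* (s * k).
  rewrite /S /C /=; simpc; congr (_ +i* _).
    rewrite (_ : _ + _ = p * c * (k ^+ 2 + s ^+ 2)); last by ring.
    by rewrite ks subrK mulr1.
  rewrite (_ : _ + _ = s * k * (c ^+ 2 - p ^+ 2)); last by ring.
  by rewrite cp addrAC subrr add0r mulr1.
have nC : complex.Re C ^+ 2 + complex.Im C ^+ 2 = p ^+ 2 + k ^+ 2.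
  by rewrite /C /= !exprMn cp ks; ring.
have nS : complex.Re S ^+ 2 + complex.Im S ^+ 2 = p ^+ 2 + s ^+ 2.
  by rewrite /S /= !exprMn cp ks; ring.
(* |C|^2 >= sinh (da)^2 > 0: the tangent has no pole in the quadrant. *)
have C0 : C != 0.
  apply/eqP => C0; move: nC; rewrite C0 /= expr0n /= addr0 => /esym/eqP.
  by rewrite paddr_eq0 ?sqr_ge0 // sqrf_eq0 gt_eqF.
have /andP[skl skr] : - (d * b) <= s * k <= d * b by rewrite -ler_norml.
have [Re0 Im0] : 0 < complex.Re (u' * (v' * C + u' * S) * (u' * C + v' * S)^*%C) /\
  0 <= complex.Im (u' * (v' * C + u' * S) * (u' * C + v' * S)^*%C).
  rewrite !layer_step_identity SC nC nS /u' /v' (expr2 (_ +i* _)); simpc => /=.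
  have aapc : d * a * a <= a * (p * c) by rewrite mulrC ler_wpM2l // ltW.
  have bapc : d * a * b <= b * (p * c) by rewrite mulrC ler_wpM2l // ltW.
  have bsk : `|b * (s * k)| <= d * a * a.
    rewrite normrM (ger0_norm b0) (le_trans (ler_wpM2l b0 skb)) //.
    rewrite mulrC -!mulrA ler_wpM2l ?(ltW d0) //.
    by rewrite ler_pM.
  have ask : `|a * (s * k)| <= d * a * b.
    rewrite normrM (gtr0_norm a0) (le_trans (ler_wpM2l (ltW a0) skb)) //.
    by rewrite mulrCA mulrA.
  move: bsk ask; rewrite !ler_norml => /andP[bsk1 bsk2] /andP[ask1 ask2].
  have b2a2 : b * b <= a * a by rewrite ler_pM.
  have u2 : 0 < a ^+ 2 + b ^+ 2 by rewrite ltr_pwDl ?exprn_gt0 // sqr_ge0.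
  have v2 : 0 <= x ^+ 2 + y ^+ 2 by rewrite addr_ge0 ?sqr_ge0.
  split.
    rewrite -addrA ltr_pwDl //.
      rewrite mulr_gt0 // ltr_pwDl //; last by lra.
      by rewrite mulr_gt0 // ltr_pwDl ?exprn_gt0 // sqr_ge0.
    have aby := mulr_ge0 (mulr_ge0 (ltW a0) b0) y0.
    have abx : 0 <= (a * a - b * b) * x by rewrite mulr_ge0 ?subr_ge0 // ltW.
    apply: addr_ge0; apply: mulr_ge0 => //; first by lra.
      by rewrite addr_ge0 ?sqr_ge0.
    by lra.
  have T : 0 <= (x ^+ 2 + y ^+ 2) * (b * (p * c) - a * (s * k)).
    by rewrite mulr_ge0 //; lra.
  have T2 : 0 <= (a ^+ 2 + b ^+ 2) * (b * (p * c) + a * (s * k)).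
    by rewrite mulr_ge0 ?(ltW u2) //; lra.
  have T3 : 0 <= (p ^+ 2 + s ^+ 2) * (2 * a * b * x).
    by rewrite !mulr_ge0 ?addr_ge0 ?sqr_ge0 // ltW.
  (* |u|^2 |C|^2 - |S|^2 Re (u^2) = a^2 + b^2 + 2 (b^2 sinh^2 - a^2 sin^2), and
     b sinh (da) >= d a b >= a |sin (db)|. *)
  have T4 : 0 <= y * ((a ^+ 2 + b ^+ 2) * (p ^+ 2 + k ^+ 2) -
                      (p ^+ 2 + s ^+ 2) * (a ^+ 2 - b ^+ 2)).
    apply: mulr_ge0 => //; rewrite ks.
    have bp : (d * a * b) ^+ 2 <= (b * p) ^+ 2.
      rewrite ler_sqr ?nnegrE ?mulr_ge0 ?(ltW d0) ?(ltW a0) ?(ltW p0) //.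
      by rewrite mulrC ler_wpM2l.
    have as' : (a * s) ^+ 2 <= (d * a * b) ^+ 2.
      rewrite -real_normK ?num_real // ler_sqr ?nnegrE ?mulr_ge0 ?(ltW d0) ?(ltW a0) //.
      by rewrite normrM (gtr0_norm a0) -mulrA mulrCA ler_wpM2l // ltW.
    have := exprn_gt0 2 a0; have := sqr_ge0 b.
    move: bp as'; rewrite !exprMn; move: (a ^+ 2) (b ^+ 2) (p ^+ 2) (s ^+ 2) (d ^+ 2).
    move=> a2 b2 p2 s2 d2; lra.
  move: T T2 T3 T4; lra.
have uv0 : u' * C + v' * S != 0.
  by apply: contraTneq Re0 => ->; rewrite conjc0 mulr0 /= ltxx.
have E w z : w + z * (S / C) = (w * C + z * S) / C by rewrite mulrDl mulfK // mulrA.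
split; first by rewrite E mulf_neq0 ?invr_neq0.
rewrite !E invfM invrK mulrACA mulVf // mulr1 mulrA.
rewrite complex_divE /quadrant /=.
have D : 0 < complex.Re (u' * C + v' * S) ^+ 2 + complex.Im (u' * C + v' * S) ^+ 2.
  move: uv0; rewrite lt_def addr_ge0 ?sqr_ge0 // andbT.
  by case: (u' * C + v' * S) => r i; apply: contraNneq => /eqP /=;
    rewrite paddr_eq0 ?sqr_ge0 // !sqrf_eq0 eq_complex.
by rewrite divr_gt0 // divr_ge0 // ltW.
Qed.

End wave.

(** * Surface admittances and reflection factors *)

Section admittance.
Context {R : realType} (om : R).
Local Open Scope complex_scope.
Hypothesis om_gt0 : 0 < om.

(** The surface admittance multiplied by i mu0 omega. *)
Fixpoint scaled_admittance (lam : R) (n : nat) :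
    ('I_n.+1 -> R) -> ('I_n -> R) -> R[i] :=
  match n with
  | 0 => fun sigma _ => wavenumber om lam (sigma ord0)
  | n'.+1 => fun sigma d =>
      layer_step (d ord0) (wavenumber om lam (sigma ord0))
        (scaled_admittance lam (fun k => sigma (lift ord0 k))
                               (fun k => d (lift ord0 k)))
  end.

Lemma scale_neq0 : (mu0 R * om) *i != 0.
Proof. by rewrite eq_complex /= eqxx gt_eqF // mulr_gt0 // mu0_gt0. Qed.

Lemma admittanceE (lam : R) n (sigma : 'I_n.+1 -> R) (d : 'I_n -> R) :
  admittance om lam sigma d = scaled_admittance lam sigma d / ((mu0 R * om) *i).
Proof.
elim: n sigma d => [//|n IHn] sigma d /=; rewrite IHn /layer_step /layerN.
have := scale_neq0; set k := _ *i => k0.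
set u := wavenumber _ _ _; set v := scaled_admittance _ _ _; set t := ctanh _.
have E x y : x / k + y / k * t = (x + y * t) / k by rewrite mulrDl mulrAC.
have K A D : A / k / (D / k) = A / D by rewrite invfM invrK mulrACA mulVf // mulr1.
by rewrite !E K mulrAC.
Qed.

Lemma reflectionE (lam : R) n (sigma : 'I_n.+1 -> R) (d : 'I_n -> R)
    (v := scaled_admittance lam sigma d) :
  reflection d sigma om lam = (lam%:C - v) / (lam%:C + v).
Proof.
rewrite /reflection admittanceE -/v /airN -mulrBl -mulrDl.
by rewrite invfM invrK mulrACA mulVf ?mulr1 // scale_neq0.
Qed.

Lemma scaled_admittance_quadrant (lam : R) n (sigma : 'I_n.+1 -> R) (d : 'I_n -> R) :
  0 < lam -> (forall i, 0 < d i) -> (forall i, 0 <= sigma i) ->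
  quadrant (scaled_admittance lam sigma d).
Proof.
move=> lam0; elim: n sigma d => [|n IHn] sigma d d0 s0 /=.
  by have [] := wavenumber_quadrant om_gt0 lam0 (s0 ord0).
have [uq ule] := wavenumber_quadrant om_gt0 lam0 (s0 ord0).
by apply: (layer_step_quadrant _ uq ule _).2 => //; exact: IHn.
Qed.

(** With v = x + i y and x > 0, the point v is nearer to lambda than to - lambda. *)
Lemma reflection_le1 (lam : R) n (sigma : 'I_n.+1 -> R) (d : 'I_n -> R) :
  0 < lam -> (forall i, 0 < d i) -> (forall i, 0 <= sigma i) ->
  `|complex.Re (reflection d sigma om lam)| <= 1 /\
  `|complex.Im (reflection d sigma om lam)| <= 1.
Proof.
move=> lam0 d0 s0; rewrite reflectionE complex_divE.
have := scaled_admittance_quadrant lam0 d0 s0.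
case: scaled_admittance => x y /andP[/= x0 y0].
simpc => /=.
have n0 : 0 < (lam + x) ^+ 2 + y ^+ 2.
  by rewrite ltr_pwDl ?sqr_ge0 // exprn_gt0 // addr_gt0.
rewrite !normrM !normfV (gtr0_norm n0) !ler_pdivrMr // !mul1r.
have h1 := mulr_gt0 lam0 x0; have h2 := sqr_ge0 (lam - y); have h3 := sqr_ge0 x.
have h4 := sqr_ge0 y; have h5 := mulr_ge0 (ltW lam0) y0; have h6 := sqr_ge0 lam.
by split; rewrite ler_norml; apply/andP; split; nra.
Qed.

End admittance.

(** * Continuity of the reflection factor *)

Section complex_cvg.
Local Open Scope complex_scope.
Context {R : realType} {T : Type} (F : set_system T) {FF : Filter F}.
Implicit Types (f g : T -> R[i]) (l k : R[i]).

(** Convergence of complex numbers, by components since the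
    integrals and the Frobenius norm are handled through its real and imaginary parts. *)
Definition ccvg f l :=
  (complex.Re (f t) @[t --> F] --> complex.Re l) /\
  (complex.Im (f t) @[t --> F] --> complex.Im l).

Lemma ccvg_cst l : ccvg (fun=> l) l.
Proof. by split; exact: cvg_cst. Qed.

Lemma ccvg_real (f : T -> R) (l : R) :
  f t @[t --> F] --> l -> ccvg (fun t => (f t)%:C) l%:C.
Proof. by move=> fl; split => //=; exact: cvg_cst. Qed.

Lemma ccvgD f g l k : ccvg f l -> ccvg g k -> ccvg (fun t => f t + g t) (l + k).
Proof.
move=> [fr fi] [gr gi]; split.
  rewrite (_ : complex.Re (l + k) = complex.Re l + complex.Re k); last first.
    by case: l k {fr fi gr gi} => [? ?] [? ?].
  rewrite (_ : (fun t => _) = (fun t => complex.Re (f t) + complex.Re (g t))).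
    exact: cvgD.
  by apply/funext => t; case: (f t) (g t) => [? ?] [? ?].
rewrite (_ : complex.Im (l + k) = complex.Im l + complex.Im k); last first.
  by case: l k {fr fi gr gi} => [? ?] [? ?].
rewrite (_ : (fun t => _) = (fun t => complex.Im (f t) + complex.Im (g t))).
  exact: cvgD.
by apply/funext => t; case: (f t) (g t) => [? ?] [? ?].
Qed.

Lemma ccvgN f l : ccvg f l -> ccvg (fun t => - f t) (- l).
Proof.
move=> [fr fi]; split.
  rewrite (_ : complex.Re (- l) = - complex.Re l); last by case: l {fr fi}.
  rewrite (_ : (fun t => _) = (fun t => - complex.Re (f t))); first exact: cvgN.
  by apply/funext => t; case: (f t).
rewrite (_ : complex.Im (- l) = - complex.Im l); last by case: l {fr fi}.
rewrite (_ : (fun t => _) = (fun t => - complex.Im (f t))); first exact: cvgN.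
by apply/funext => t; case: (f t).
Qed.

Lemma ccvgM f g l k : ccvg f l -> ccvg g k -> ccvg (fun t => f t * g t) (l * k).
Proof.
pose re (x y : R[i]) := complex.Re x * complex.Re y - complex.Im x * complex.Im y.
pose im (x y : R[i]) := complex.Re x * complex.Im y + complex.Im x * complex.Re y.
have reE x y : complex.Re (x * y) = re x y by case: x y => [? ?] [? ?].
have imE x y : complex.Im (x * y) = im x y by case: x y => [? ?] [? ?].
move=> [fr fi] [gr gi]; split.
  rewrite reE (_ : (fun t => _) = (fun t => re (f t) (g t))).
    by apply: cvgB; exact: cvgM.
  by apply/funext => t; rewrite reE.
rewrite imE (_ : (fun t => _) = (fun t => im (f t) (g t))).
  by apply: cvgD; exact: cvgM.
by apply/funext => t; rewrite imE.
Qed.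

Lemma ccvgV f l : l != 0 -> ccvg f l -> ccvg (fun t => (f t)^-1) l^-1.
Proof.
pose n (x : R[i]) := complex.Re x ^+ 2 + complex.Im x ^+ 2.
have reE x : complex.Re x^-1 = complex.Re x / n x by case: x => [? ?].
have imE x : complex.Im x^-1 = - (complex.Im x / n x) by case: x => [? ?].
move=> l0 [fr fi].
have nl : n l != 0.
  by move: l0; rewrite eq_complex /n paddr_eq0 ?sqr_ge0 // !sqrf_eq0.
have nf : (n (f t))^-1 @[t --> F] --> (n l)^-1.
  by apply: cvgV => //; apply: cvgD; exact: cvgM.
split.
  rewrite reE; under eq_fun do rewrite reE.
  exact: cvgM.
rewrite imE; under eq_fun do rewrite imE.
by apply: cvgN; exact: cvgM.
Qed.

Lemma ccvg_exp f l : ccvg f l -> ccvg (fun t => cexp (f t)) (cexp l).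
Proof.
move=> [fr fi]; apply: ccvgM.
  by apply: ccvg_real; apply: continuous_cvg fr; exact: continuous_expR.
split => /=.
  by apply: continuous_cvg fi; exact: continuous_cos.
by apply: continuous_cvg fi; exact: continuous_sin.
Qed.

(** |cosh z|^2 = cosh^2 (Re z) cos^2 (Im z) + sinh^2 (Re z) sin^2 (Im z) vanishes
    only on the imaginary axis. *)
Lemma ccvg_tanh f l : 0 < complex.Re l ->
  ccvg f l -> ccvg (fun t => ctanh (f t)) (ctanh l).
Proof.
move=> l0 fl; have fp := ccvg_exp fl; have fn := ccvg_exp (ccvgN fl).
apply: ccvgM; first by apply: ccvgD => //; exact: ccvgN.
apply: ccvgV; last exact: ccvgD.
have sh0 : 0 < sh (complex.Re l) by apply: lt_le_trans l0 (sh_ge (ltW l0)).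
have ch0 : 0 < ch (complex.Re l) by apply: lt_le_trans (ch_ge1 _).
rewrite cexp2; move: sh0 ch0; move: (sh _) (ch _) => p c sh0 ch0.
rewrite mulf_eq0 !eq_complex /= eqxx andbT pnatr_eq0 /= negb_and !mulf_eq0.
rewrite (gt_eqF ch0) (gt_eqF sh0) /= -negb_and; apply/negP => /andP[/eqP c0 /eqP s0].
by have := cos2Dsin2 (complex.Im l); rewrite c0 s0 expr0n /= addr0 => /esym/eqP;
   rewrite oner_eq0.
Qed.

Lemma ccvg_wavenumber om (lam s : T -> R) (lam0 s0 : R) : 0 < om ->
  (forall t, 0 <= s t) -> 0 <= s0 ->
  lam t @[t --> F] --> lam0 -> s t @[t --> F] --> s0 ->
  ccvg (fun t => wavenumber om (lam t) (s t)) (wavenumber om lam0 s0).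
Proof.
move=> om0 sge0 s0ge0 laml sl.
have l2 : lam t ^+ 2 @[t --> F] --> lam0 ^+ 2 by exact: cvgM.
have c2 : (s t * mu0 R * om) ^+ 2 @[t --> F] --> (s0 * mu0 R * om) ^+ 2.
  by apply: cvgM; apply: cvgM; try exact: cvg_cst; apply: cvgM => //; exact: cvg_cst.
have r : Num.sqrt (lam t ^+ 2 ^+ 2 + (s t * mu0 R * om) ^+ 2) @[t --> F] -->
   Num.sqrt (lam0 ^+ 2 ^+ 2 + (s0 * mu0 R * om) ^+ 2).
  apply: (@continuous_cvg _ _ _ _ _ _ Num.sqrt); first exact: sqrt_continuous.
  by apply: cvgD => //; exact: cvgM.
rewrite wavenumberE ?(ltW om0) //.
under eq_fun do rewrite wavenumberE ?(ltW om0) //.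
split => /=; apply: (@continuous_cvg _ _ _ _ _ _ Num.sqrt); try exact: sqrt_continuous.
  by apply: cvgM; [exact: cvgD|exact: cvg_cst].
by apply: cvgM; [exact: cvgB|exact: cvg_cst].
Qed.

(** Joint continuity in the conductivities and in lambda, along an arbitrary
    filter: a sequence of conductivities with lambda fixed gives the pointwise
    convergence of the integrands, and neighbourhoods of lambda with the
    conductivities fixed give their measurability.  Only denominators at the
    limit point have to be non-zero, which the quadrant guarantees. *)
Lemma ccvg_reflection om n (d : 'I_n -> R) (lam : T -> R) (s : T -> 'I_n.+1 -> R)
    (lam0 : R) (s0 : 'I_n.+1 -> R) : 0 < om -> (forall i, 0 < d i) ->
  0 < lam0 -> (forall t i, 0 <= s t i) -> (forall i, 0 <= s0 i) ->
  lam t @[t --> F] --> lam0 -> (forall i, s t i @[t --> F] --> s0 i) ->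
  ccvg (fun t => reflection d (s t) om (lam t)) (reflection d s0 om lam0).
Proof.
move=> om_gt0 d0 lam0_gt0 sge0 s0ge0 laml sl.
have vl : ccvg (fun t => scaled_admittance om (lam t) (s t) d)
               (scaled_admittance om lam0 s0 d).
  elim: n d s s0 d0 sge0 s0ge0 sl => [|n IHn] d s s0 d0 sge0 s0ge0 sl /=.
    exact: ccvg_wavenumber.
  have ul : ccvg (fun t => wavenumber om (lam t) (s t ord0))
                 (wavenumber om lam0 (s0 ord0)) by exact: ccvg_wavenumber.
  have [uq ule] := wavenumber_quadrant om_gt0 lam0_gt0 (s0ge0 ord0).
  have vq : quadrant (scaled_admittance om lam0 (fun i => s0 (lift ord0 i))
                                                (fun i => d (lift ord0 i))).
    exact: scaled_admittance_quadrant.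
  have [den0 _] := layer_step_quadrant (d0 ord0) uq ule vq.
  have tl : ccvg (fun t => ctanh ((d ord0)%:C * wavenumber om (lam t) (s t ord0)))
                 (ctanh ((d ord0)%:C * wavenumber om lam0 (s0 ord0))).
    apply: ccvg_tanh; last by apply: ccvgM => //; exact: ccvg_cst.
    move: uq; case: wavenumber => a b /andP[/= a0 _].
    by rewrite mul0r subr0 mulr_gt0.
  have IH := IHn (fun i => d (lift ord0 i)) (fun t i => s t (lift ord0 i))
    (fun i => s0 (lift ord0 i)) (fun i => d0 _) (fun t i => sge0 t _)
    (fun i => s0ge0 _) (fun i => sl _).
  apply: ccvgM => //; apply: ccvgM.
    by apply: ccvgD => //; exact: ccvgM.
  by apply: ccvgV => //; apply: ccvgD => //; exact: ccvgM.
rewrite reflectionE //; under eq_fun do rewrite reflectionE //.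
have ll := ccvg_real laml.
apply: ccvgM; first by apply: ccvgD => //; exact: ccvgN.
apply: ccvgV; last exact: ccvgD.
apply: quadrant_neq0; have := scaled_admittance_quadrant om_gt0 lam0_gt0 d0 s0ge0.
case: scaled_admittance => x y /andP[/= x0 y0].
by rewrite /quadrant /= add0r y0 addr_gt0.
Qed.

End complex_cvg.

(** * Bessel functions of orders zero and one are bounded by one *)

Section bessel.
Context {R : realType}.
Implicit Types (x y : R) (nu k : nat).

(** The Bessel-Clifford functions, up to a sign of the variable:
    J_nu (x) = (x / 2)^nu clifford nu ((x / 2)^2).  They are entire and free of
    the singularity at 0 of the Bessel equation. *)
Definition clifford_coef nu k : R := (-1) ^+ k / (k`! * (k + nu)`!)%:R.

Definition clifford nu y : R := limn (pseries (clifford_coef nu) y).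

Lemma is_cvg_clifford nu y : cvgn (pseries (clifford_coef nu) y).
Proof.
apply: normed_cvg.
apply: (@series_le_cvg R _ (exp_coeff `|y|)) => [k|k|k|].
- exact: normr_ge0.
- by rewrite /exp_coeff /= divr_ge0 ?exprn_ge0.
- rewrite /= /exp_coeff /clifford_coef !normrM normfV normrX normrN1 expr1n mul1r.
  rewrite normrX normr_nat mulrC ler_wpM2l ?exprn_ge0 //.
  rewrite lef_pV2 ?posrE ?ltr0n ?muln_gt0 ?fact_gt0 // ler_nat.
  by rewrite leq_pmulr ?fact_gt0.
- exact: is_cvg_series_exp_coeff.
Qed.

Lemma clifford_cvg nu y : pseries (clifford_coef nu) y @ \oo --> clifford nu y.
Proof. exact: is_cvg_clifford. Qed.

Lemma diffs_clifford_coef nu :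
  pseries_diffs (clifford_coef nu) = - clifford_coef nu.+1.
Proof.
apply/funext => k; rewrite /pseries_diffs /clifford_coef !fctE.
rewrite exprS factS addSn -addnS !natrM.
have k0 : k.+1%:R != 0 :> R by rewrite pnatr_eq0.
have f0 n : n`!%:R != 0 :> R by rewrite pnatr_eq0 -lt0n fact_gt0.
move: (k.+1%:R) k0 => a a0.
by field; rewrite !f0 a0.
Qed.

Lemma pseriesN (c : nat -> R) y : pseries (- c) y = - pseries c y.
Proof.
by apply/funext => n; rewrite /pseries /series !fctE /= -sumrN; apply: eq_bigr => i _;
  rewrite mulNr.
Qed.

Lemma is_derive_clifford nu y : is_derive y (1 : R) (clifford nu) (- clifford nu.+1 y).
Proof.
rewrite /clifford -limN; last exact: is_cvg_clifford.
rewrite -pseriesN -diffs_clifford_coef.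
apply: (@pseries_snd_diffs R _ (`|y| + 1)).
- exact: is_cvg_clifford.
- by rewrite diffs_clifford_coef pseriesN; apply: is_cvgN; exact: is_cvg_clifford.
- rewrite diffs_clifford_coef pseries_diffsN diffs_clifford_coef !pseriesN.
  by do 2!apply: is_cvgN; exact: is_cvg_clifford.
- by rewrite [ltRHS]ger0_norm ?addr_ge0 // ltrDl.
Qed.

Lemma clifford_recurrence y : y * clifford 2 y = clifford 1 y - clifford 0 y.
Proof.
suff : (fun n => y * pseries (clifford_coef 2) y n) @ \oo -->
       clifford 1 y - clifford 0 y.
  apply: cvg_unique => //; apply: cvgM; [exact: cvg_cst | exact: clifford_cvg].
have -> : (fun n => y * pseries (clifford_coef 2) y n) =
  (fun n => pseries (clifford_coef 1) y n.+1 - pseries (clifford_coef 0) y n.+1).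
  apply/funext => n; rewrite /pseries /series /= mulr_sumr -sumrB big_nat_recl //.
  rewrite !expr0 /clifford_coef !addn0 add0n fact0 subrr add0r.
  apply: eq_bigr => k _; rewrite !exprS addn1 addn2 addn0 !factS !natrM.
  by field; rewrite -(natrD _ 1) -(natrD _ 2) !pnatr_eq0 /= -!lt0n !fact_gt0.
by apply: cvgB; rewrite (cvg_shiftS (pseries _ y)); exact: clifford_cvg.
Qed.

Lemma clifford0 : clifford 0 0 = 1.
Proof.
apply: cvg_lim => //; rewrite -cvg_shiftS.
rewrite (_ : (fun n => _) = cst 1); first exact: cvg_cst.
apply/funext => n; rewrite /pseries /series /= big_nat_recl // big1 => [|k _].
  by rewrite addr0 expr0 /clifford_coef fact0 expr0 mulr1 divr1.
by rewrite exprS mul0r mulr0.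
Qed.

(** At y = (x / 2)^2 the left-hand side is J_0 (x)^2 + J_1 (x)^2.  Its derivative
    in y is - clifford 1 y ^ 2, by clifford nu ' = - clifford (nu + 1) and the
    three-term recurrence, and its value at 0 is 1. *)
Lemma clifford_energy_le1 y : 0 <= y ->
  clifford 0 y ^+ 2 + y * clifford 1 y ^+ 2 <= 1.
Proof.
move=> y0.
pose E y : R := clifford 0 y * clifford 0 y + y * (clifford 1 y * clifford 1 y).
have E0 : E 0 = 1 by rewrite /E clifford0 mul0r addr0 mulr1.
rewrite -E0 -[leLHS]/(E y) -lerN2.
apply: (@ge0_ndecr R (- E) (fun y => clifford 1 y ^+ 2)) => //; last first.
  by move=> z _; exact: sqr_ge0.
move=> z.
have d0 := is_derive_clifford 0 z; have d1 := is_derive_clifford 1 z.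
have dE : is_derive z (1 : R) E (- clifford 1 z ^+ 2).
  have := is_deriveD (is_deriveM d0 d0)
    (is_deriveM (is_derive_id z 1) (is_deriveM d1 d1)).
  move/is_derive_eq; apply.
  rewrite /GRing.scale /= !fctE.
  have := clifford_recurrence z.
  set a := clifford 0 z; set b := clifford 1 z; set c := clifford 2 z => r.
  have -> : z * (b * - c + b * - c) = - 2 * b * (z * c) by ring.
  rewrite r; ring.
by apply: is_derive_eq; rewrite opprK.
Qed.

Lemma besselJE nu x : besselJ nu x = (x / 2) ^+ nu * clifford nu ((x / 2) ^+ 2).
Proof.
apply: cvg_lim => //.
rewrite (_ : series _ =
  fun n => (x / 2) ^+ nu * pseries (clifford_coef nu) ((x / 2) ^+ 2) n).
  by apply: cvgM; [exact: cvg_cst | exact: clifford_cvg].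
apply/funext => n; rewrite /pseries /series /= mulr_sumr.
by apply: eq_bigr => k _; rewrite exprD exprM -/(clifford_coef nu k); ring.
Qed.

Lemma besselJ_le1 nu x : (nu < 2)%N -> `|besselJ nu x| <= 1.
Proof.
move=> nu2; rewrite besselJE.
have := clifford_energy_le1 (sqr_ge0 (x / 2)).
set a := clifford 0 _ => E; rewrite -[leRHS]normr1 -ler_sqr ?nnegrE // !real_normK ?num_real //.
rewrite expr1n; apply: le_trans E; case: nu nu2 => [|[|//]] _.
  by rewrite expr0 mul1r lerDl mulr_ge0 ?sqr_ge0.
by rewrite expr1 exprMn lerDr sqr_ge0.
Qed.

Lemma continuous_besselJ nu : continuous (@besselJ R nu).
Proof.
have cP : continuous (clifford nu).
  move=> y; apply: differentiable_continuous; apply/derivable1_diffP.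
  by have [] := is_derive_clifford nu y.
have cX k : continuous (fun x : R => (x / 2) ^+ k).
  move=> x; apply: (@continuous_comp _ _ _ (fun x : R => x / 2) (fun x => x ^+ k)).
    by apply: cvgM; [exact: cvg_id | exact: cvg_cst].
  exact: exprn_continuous.
move=> x; rewrite (_ : besselJ nu =
  fun x => (x / 2) ^+ nu * clifford nu ((x / 2) ^+ 2)); last first.
  by apply/funext => z; exact: besselJE.
apply: cvgM; first exact: cX.
apply: (@continuous_comp _ _ _ (fun x : R => (x / 2) ^+ 2) (clifford nu)).
  exact: cX.
exact: cP.
Qed.

End bessel.

(** * Continuity of the forward operator *)

Section halfline_integrals.
Context {R : realType}.
Notation mu := (@lebesgue_measure R).

(** t <= e^t at t = h x / 2, raised to the power k <= 2. *)
Lemma exprn_le_expR (h x : R) (k : nat) : 0 < h -> 0 <= x -> (k <= 2)%N ->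
  x ^+ k <= (2 / h) ^+ k * expR (h * x).
Proof.
move=> h0 x0 k2.
have x1 : x <= 2 / h * expR (h * x / 2).
  rewrite -ler_pdivrMl ?divr_gt0 // invf_div.
  have := @expR_ge1Dx R (h * x / 2); lra.
have e1 : 1 <= expR (h * x / 2).
  by rewrite -expR0 ler_expR divr_ge0 // mulr_ge0 // ltW.
have -> : expR (h * x) = expR (h * x / 2) ^+ 2 by rewrite -expRM_natl; congr expR; field.
apply: (@le_trans _ _ ((2 / h * expR (h * x / 2)) ^+ k)).
  by rewrite lerXn2r // nnegrE mulr_ge0 ?expR_ge0 // divr_ge0 // ltW.
rewrite exprMn; apply: ler_wpM2l; last exact: ler_weXn2l.
by rewrite exprn_ge0 // divr_ge0 // ltW.
Qed.

(** Dominated convergence, the dominating function being a multiple of the density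
    of the exponential law.  Nothing is known of g at 0, where w vanishes, so that
    continuity of w g is only available on the open half-line; this suffices for
    measurability, a single point being measurable. *)
Lemma Rintegral_weighted_cvg (h c : R) (w g : R -> R) (g_ : nat -> R -> R) :
  0 < h -> continuous w ->
  (forall x : R, 0 <= x -> `|w x| <= c * expR (- h * x)) ->
  w 0 = 0 ->
  (forall x : R, 0 < x -> {for x, continuous g}) ->
  (forall k (x : R), 0 < x -> {for x, continuous (g_ k)}) ->
  (forall x : R, 0 < x -> `|g x| <= 1) ->
  (forall k (x : R), 0 < x -> `|g_ k x| <= 1) ->
  (forall x : R, 0 < x -> g_ k x @[k --> \oo] --> g x) ->
  \int[mu]_(x in `[0, +oo[) (w x * g_ k x) @[k --> \oo] -->
  \int[mu]_(x in `[0, +oo[) (w x * g x).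
Proof.
move=> h0 cw wle w0 cg cg_ g1 g_1 gl.
have mD : measurable (`[0, +oo[%classic : set (measurableTypeR R)) by exact: measurable_itv.
have mf (f : R -> R) : (forall x : R, 0 < x -> {for x, continuous f}) ->
    measurable_fun (`[0, +oo[%classic : set (measurableTypeR R)) (EFin \o (fun x => w x * f x)).
  move=> cf; apply/measurable_EFinP/measurable_fun_itv_obnd_cbndP.
  apply: open_continuous_measurable_fun; first exact: interval_open.
  move=> x; rewrite inE /= in_itv /= andbT => x0.
  by apply: cvgM; [exact: cw | exact: cf].
have ig : mu.-integrable `[0, +oo[ (EFin \o (fun x => c / h * exponential_pdf h x)).
  apply: (integrableZl mD (c / h) (f := EFin \o exponential_pdf h)).
  by apply: integrableS (integrable_exponential_pdf h0).
have le_g (f : R -> R) x : (forall x : R, 0 < x -> `|f x| <= 1) -> 0 <= x ->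
    `|w x * f x| <= c / h * exponential_pdf h x.
  move=> f1 x0; rewrite exponential_pdfE // mulrA divfK ?gt_eqF //.
  move: (x0); rewrite le_eqVlt => /predU1P[<-|xgt0].
    by rewrite w0 mul0r normr0; apply: le_trans (wle 0 _); rewrite ?w0 ?normr0.
  by apply: le_trans (wle x x0); rewrite normrM ler_piMr // f1.
have ixg : mu.-integrable `[0, +oo[ (EFin \o (fun x => w x * g x)).
  apply: le_integrable ig => //; first exact: mf.
  move=> x; rewrite /= in_itv /= andbT => x0.
  rewrite lee_fin; apply: le_trans (le_g g x g1 x0) _; exact: ler_norm.
apply: fine_cvg; rewrite fineK; last exact: integrable_fin_num.
apply: (@dominated_cvg _ _ _ mu _ mD (fun k => EFin \o (fun x => w x * g_ k x)) _
  (EFin \o (fun x => c / h * exponential_pdf h x))) => //.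
- by move=> k; apply: mf; exact: cg_.
- move=> x; rewrite /= in_itv /= andbT le_eqVlt => /predU1P[<-|x0].
    by rewrite w0 mul0r; under eq_fun do rewrite mul0r; exact: cvg_cst.
  apply: cvg_EFin; first by near=> k.
  by apply: cvgM; [exact: cvg_cst | exact: gl].
- move=> k x; rewrite /= in_itv /= andbT => x0.
  by rewrite lee_fin le_g //; exact: g_1.
Unshelve. all: by end_near. Qed.

End halfline_integrals.

Section fdem.
Context {R : realType}.
Local Open Scope complex_scope.

(** The Hankel kernel is dominated by lambda^(2 - nu) e^(- 2 h lambda), because
    Bessel functions and reflection factors are bounded by one, hence by a
    multiple of e^(- h lambda), uniformly in the conductivities. *)
Lemma fdem_cvg n (d : 'I_n -> R) nu (s_ : nat -> 'I_n.+1 -> R) (s : 'I_n.+1 -> R)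
    (h om rho : R) :
  (nu < 2)%N -> (forall i, 0 < d i) -> 0 < h -> 0 < om ->
  (forall k i, 0 <= s_ k i) -> (forall i, 0 <= s i) ->
  (forall i, s_ k i @[k --> \oo] --> s i) ->
  ccvg \oo (fun k => fdem d nu (s_ k) h om rho) (fdem d nu s h om rho).
Proof.
move=> nu2 d0 h0 om0 s_0 s0 sl.
pose w (x : R) : R := x ^+ (1 - nu) * expR (- 2 * h * x) * (besselJ nu (rho * x) * x).
have cw : continuous w.
  move=> x; apply: cvgM; first apply: cvgM.
  - exact: exprn_continuous.
  - apply: (@continuous_comp _ _ _ (fun x : R => - 2 * h * x) expR).
      by apply: cvgM; [exact: cvg_cst | exact: cvg_id].
    exact: continuous_expR.
  - apply: cvgM; last exact: cvg_id.
    apply: (@continuous_comp _ _ _ (fun x : R => rho * x) (besselJ nu)).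
      by apply: cvgM; [exact: cvg_cst | exact: cvg_id].
    exact: continuous_besselJ.
have w0 : w 0 = 0 by rewrite /w !mulr0.
have wle (x : R) : 0 <= x -> `|w x| <= (2 / h) ^+ (1 - nu).+1 * expR (- h * x).
  move=> x0; rewrite /w !normrM (ger0_norm x0) normrX (ger0_norm x0).
  rewrite (ger0_norm (expR_ge0 _)).
  apply: (@le_trans _ _ (x ^+ (1 - nu).+1 * expR (- 2 * h * x))).
    rewrite exprS [x * _]mulrC -!mulrA ler_wpM2l ?exprn_ge0 //.
    rewrite [x * _]mulrC ler_wpM2l ?expR_ge0 //.
    by rewrite ler_piMl // besselJ_le1.
  have -> : expR (- h * x) = expR (h * x) * expR (- 2 * h * x).
    by rewrite -expRD; congr expR; ring.
  by rewrite mulrA ler_wpM2r ?expR_ge0 // exprn_le_expR // ltnS leq_subr.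
have cr (f : 'I_n.+1 -> R) (x : R) : (forall i, 0 <= f i) -> 0 < x ->
    ccvg (nbhs x) (reflection d f om) (reflection d f om x).
  move=> f0 x0; apply: (@ccvg_reflection R R (nbhs x) _ om n d id (fun=> f) x f) => //.
  by move=> i; exact: cvg_cst.
have ReE f : complex.Re (cintegral `[0, +oo[ (fun x : R =>
    (x ^+ (1 - nu) * expR (- 2 * h * x))%:C * reflection d f om x *
    (besselJ nu (rho * x) * x)%:C)) =
    \int[lebesgue_measure]_(x in `[0, +oo[) (w x * complex.Re (reflection d f om x)).
  rewrite /=; apply: eq_Rintegral => x _; case: reflection => a b /=.
  by rewrite /w; ring.
have ImE f : complex.Im (cintegral `[0, +oo[ (fun x : R =>
    (x ^+ (1 - nu) * expR (- 2 * h * x))%:C * reflection d f om x *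
    (besselJ nu (rho * x) * x)%:C)) =
    \int[lebesgue_measure]_(x in `[0, +oo[) (w x * complex.Im (reflection d f om x)).
  rewrite /=; apply: eq_Rintegral => x _; case: reflection => a b /=.
  by rewrite /w; ring.
have rl (x : R) : 0 < x ->
    ccvg \oo (fun k => reflection d (s_ k) om x) (reflection d s om x).
  by move=> x0; apply: ccvg_reflection => //; exact: cvg_cst.
apply: ccvgM; first exact: ccvg_cst.
split.
  rewrite ReE; under eq_fun do rewrite ReE.
  apply: (Rintegral_weighted_cvg h0 cw wle w0).
  - by move=> x x0; have [] := cr s x s0 x0.
  - by move=> k x x0; have [] := cr (s_ k) x (s_0 k) x0.
  - by move=> x x0; have [] := reflection_le1 om0 x0 d0 s0.
  - by move=> k x x0; have [] := reflection_le1 om0 x0 d0 (s_0 k).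
  - by move=> x x0; have [] := rl x x0.
rewrite ImE; under eq_fun do rewrite ImE.
apply: (Rintegral_weighted_cvg h0 cw wle w0).
- by move=> x x0; have [] := cr s x s0 x0.
- by move=> k x x0; have [] := cr (s_ k) x (s_0 k) x0.
- by move=> x x0; have [] := reflection_le1 om0 x0 d0 s0.
- by move=> k x x0; have [] := reflection_le1 om0 x0 d0 (s_0 k).
- by move=> x x0; have [] := rl x x0.
Qed.

End fdem.

(** * Invertibility of the discrete Laplacian *)

Section laplacian.
Context {R : realType}.

(** Discrete maximum principle.  At an index k where v is maximal, and r minimal
    among such indices, (A v)_k is the maximum times the k-th row sum plus the
    non-negative terms - A_kl (v_k - v_l).  If v_k > 0, one of them is positive:
    either the row sum, or the term of an index l of smaller rank, where v_l < v_k
    by minimality. *)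
Lemma maximum_principle m (A : 'M[R]_m) (r : 'I_m -> nat) (v : 'cV[R]_m) :
  (forall k l, l != k -> A k l <= 0) -> (forall k, 0 <= \sum_l A k l) ->
  (forall k, 0 < \sum_l A k l \/ exists2 l, (r l < r k)%N & A k l < 0) ->
  (forall k, (A *m v) k 0 <= 0) -> forall k, v k 0 <= 0.
Proof.
move=> Aoff Asum Achain Av k0; rewrite leNgt; apply/negP => vk0.
have [k1 _ k1P] := @arg_maxP _ _ _ k0 xpredT (fun k => v k 0) isT.
have vmax l : v l 0 <= v k1 0 by exact: k1P.
have v1 : 0 < v k1 0 by apply: lt_le_trans (vmax k0).
have [k vk kmin] := @arg_minnP _ k1 (fun k => v k 0 == v k1 0) r (eqxx _).
have E : (A *m v) k 0 = v k 0 * (\sum_l A k l) + \sum_(l | l != k) - A k l * (v k 0 - v l 0).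
  rewrite mxE (bigD1 k) //= [in RHS](bigD1 k) //= mulrDr -addrA mulrC; congr (_ + _).
  rewrite mulr_sumr -big_split /=; apply: eq_bigr => l _; ring.
have T l : l != k -> 0 <= - A k l * (v k 0 - v l 0).
  by move=> lk; rewrite mulr_ge0 ?oppr_ge0 ?Aoff // subr_ge0 (eqP vk).
have := Av k; rewrite E leNgt => /negP; apply.
have [s0|[l rl Al]] := Achain k.
  by rewrite ltr_pwDl ?sumr_ge0 // mulr_gt0 // (eqP vk).
rewrite ltr_wpDl ?mulr_ge0 // ?(eqP vk) ?(ltW v1) //.
have lk : l != k by apply: contraTneq rl => ->; rewrite ltnn.
rewrite (bigD1 l) //= ltr_pwDl ?sumr_ge0 //; last first.
  by move=> l' /andP[l'k _]; have := T l' l'k; rewrite (eqP vk).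
rewrite mulr_gt0 ?oppr_gt0 // subr_gt0 lt_neqAle vmax andbT.
by apply/negP => /kmin; rewrite leqNgt rl.
Qed.

Lemma lap1_off k (i j : 'I_k) : j != i -> lap1 R k i j <= 0.
Proof.
by rewrite eq_sym mxE => /negPf ->; case: ifP.
Qed.

(** A row has at most one entry -1 on each side of the diagonal, and the first row
    has none on the left. *)
Lemma lap1_sum k (i : 'I_k) :
  0 <= \sum_j lap1 R k i j /\ (val i = 0%N -> 0 < \sum_j lap1 R k i j).
Proof.
pose a : {pred 'I_k} := [pred j : 'I_k | i == j.+1 :> nat].
pose b : {pred 'I_k} := [pred j : 'I_k | j == i.+1 :> nat].
have card_sum (c : {pred 'I_k}) : \sum_j (j \in c)%:R = #|c|%:R :> R.
  rewrite -sum1_card natr_sum [in RHS]big_mkcond.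
  by apply: eq_bigr => j _; case: (j \in c).
have -> : \sum_j lap1 R k i j = 2 - #|a|%:R - #|b|%:R.
  transitivity (\sum_j (2 * (i == j)%:R - (j \in a)%:R - (j \in b)%:R : R)).
    apply: eq_bigr => j _; rewrite mxE !inE -val_eqE /=.
    case: (ltngtP i j) => ij; rewrite ?mulr0 ?mulr1 ?sub0r.
    - rewrite (_ : (val i == j.+1) = false) /=; last by apply/eqP => /=; lia.
      by rewrite oppr0 sub0r; case: eqP; rewrite ?oppr0.
    - rewrite (_ : (val j == i.+1) = false) /=; last by apply/eqP => /=; lia.
      by rewrite subr0 orbF; case: eqP; rewrite ?oppr0.
    - rewrite ij (_ : (val j == j.+1) = false) ?subr0 //; apply/eqP => /=; lia.
  rewrite !sumrB -mulr_sumr; congr (_ - _ - _).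
  - rewrite (bigD1 i) //= eqxx big1 ?addr0 ?mulr1 // => j /negPf.
    by rewrite eq_sym => ->.
  - exact: card_sum.
  - exact: card_sum.
have a1 : (#|a| <= 1)%N.
  by apply/card_le1_eqP => x y; rewrite !inE => /eqP -> /eqP[] /val_inj.
have b1 : (#|b| <= 1)%N.
  by apply/card_le1_eqP => x y; rewrite !inE => /eqP e /eqP e'; apply: val_inj; rewrite /= e e'.
have b1' : #|b|%:R <= 1 :> R by rewrite (ler_nat _ _ 1).
have a1' : #|a|%:R <= 1 :> R by rewrite (ler_nat _ _ 1).
split; first by lra.
move=> i0; have -> : #|a| = 0%N by apply: eq_card0 => j; rewrite !inE i0.
lra.
Qed.

Definition laplacian_mx (n N : nat) : 'M[R]_(N * n) :=
  lap1 R N *t 1%:M + 1%:M *t lap1 R n.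

Lemma laplacian_mxE n N (j j' : 'I_N) (i i' : 'I_n) :
  laplacian_mx n N (mxtens_index (j, i)) (mxtens_index (j', i')) =
  lap1 R N j j' * (i == i')%:R + (j == j')%:R * lap1 R n i i'.
Proof. by rewrite [LHS]mxE !tensmxE !mxE. Qed.

(** The maximum principle applies to v and to - v with the row number i as rank:
    at an interior row the entry of the neighbour i - 1 is -1, and at the first
    row the zero boundary condition makes the row sum positive. *)
Lemma laplacian_mx_inj n N (v : 'cV[R]_(N * n)) : laplacian_mx n N *m v = 0 -> v = 0.
Proof.
have le0 (u : 'cV[R]_(N * n)) : laplacian_mx n N *m u = 0 -> forall k, u k 0 <= 0.
  move=> Lu.
  have Lsum (j : 'I_N) (i : 'I_n) : \sum_l laplacian_mx n N (mxtens_index (j, i)) l =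
      \sum_j' lap1 R N j j' + \sum_i' lap1 R n i i'.
    have d1 m (x : 'I_m) : \sum_y (x == y)%:R = 1 :> R.
      by rewrite (bigD1 x) //= eqxx big1 ?addr0 // => y /negPf; rewrite eq_sym => ->.
    transitivity ((\sum_j' lap1 R N j j') * (\sum_i' (i == i')%:R) +
                  (\sum_j' (j == j')%:R) * (\sum_i' lap1 R n i i')).
      rewrite !mulr_sum -big_split.
      apply: eq_bigr => l _; case: (mxtens_indexP l) => j' i'.
      by rewrite mxtens_indexK laplacian_mxE.
    by rewrite !d1 mulr1 mul1r.
  apply: (@maximum_principle _ (laplacian_mx n N) (fun k => (mxtens_unindex k).2 : nat)).
  - move=> k l; case: (mxtens_indexP k) => j i; case: (mxtens_indexP l) => j' i' lk.
    rewrite laplacian_mxE; case: (eqVneq j j') => [jj|jj]; last first.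
      rewrite mul0r addr0 mulr_le0_ge0 // lap1_off // eq_sym //.
    case: (eqVneq i i') => [ii|ii]; first by rewrite jj ii eqxx in lk.
    by rewrite mulr0 add0r mul1r lap1_off // eq_sym.
  - move=> k; case: (mxtens_indexP k) => j i; rewrite Lsum.
    by rewrite addr_ge0 // (lap1_sum _).1.
  - move=> k; case: (mxtens_indexP k) => j i; rewrite Lsum.
    have [i0|i0] := posnP i; last right; first left.
      by rewrite ltr_wpDl ?(lap1_sum _).1 // (lap1_sum _).2.
    have ip : (i.-1 < n)%N by rewrite (leq_ltn_trans (leq_pred _) (ltn_ord i)).
    exists (mxtens_index (j, Ordinal ip)); rewrite ?mxtens_indexK /=; first by rewrite prednK.
    have ne : (i == Ordinal ip) = false.
      by rewrite -val_eqE; apply/eqP => /=; lia.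
    by rewrite laplacian_mxE eqxx mul1r ne mulr0 add0r mxE ne /= prednK // eqxx ltrN10.
  - by move=> k; rewrite Lu mxE.
move=> Lv; apply/colP => k; apply/le_anti; rewrite mxE le0 //=.
by have := le0 (- v); rewrite mulmxN Lv oppr0 => /(_ erefl k); rewrite mxE oppr_le0.
Qed.

Lemma laplacian_mx_unit n N : laplacian_mx n N \in unitmx.
Proof.
rewrite -unitmx_tr -row_free_unit -kermx_eq0; apply/eqP/row_matrixP => i.
rewrite row0; apply: trmx_inj; rewrite trmx0; apply: laplacian_mx_inj.
by apply: trmx_inj; rewrite trmx_mul trmxK trmx0 -row_mul mulmx_ker row0.
Qed.

End laplacian.

(** * Convergent subsequences in finite dimension *)

Section finite_dimension.
Context {R : realType}.

(** For q < 1 the power is not differentiable at 0; there, |f| < e^(1/q) gives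
    |f|^q < e. *)
Lemma powR_norm_cvg {T : Type} (F : set_system T) {FF : Filter F} (q : R)
    (f : T -> R) (a : R) : 0 < q ->
  f t @[t --> F] --> a -> `|f t| `^ q @[t --> F] --> `|a| `^ q.
Proof.
move=> q0 fa; have [a0|a0] := eqVneq a 0.
  rewrite a0 normr0 powR0 ?gt_eqF //; apply/cvgrPdist_lt => e e0.
  have d0 : 0 < e `^ q^-1 by exact: powR_gt0.
  move/cvgrPdist_lt : fa => /(_ _ d0); rewrite a0; apply: filterS => t.
  rewrite !sub0r !normrN => ft; rewrite ger0_norm ?powR_ge0 //.
  have -> : e = (e `^ q^-1) `^ q by rewrite -powRrM mulVf ?gt_eqF // powRr1 // ltW.
  by apply: gt0_ltr_powR; rewrite ?nnegrE // ltW.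
apply: (@continuous_cvg _ _ _ _ _ _ (fun x => x `^ q)); last exact: cvg_norm.
apply: differentiable_continuous; apply/derivable1_diffP.
by apply: derivable_powR; rewrite in_itv /= andbT normr_gt0.
Qed.

Lemma increasing_seq_cvgy (f : nat -> nat) : {homo f : i j / (i < j)%N} -> f @ \oo --> \oo.
Proof.
move=> fi; have fge k : (k <= f k)%N.
  by elim: k => // k IHk; apply: leq_ltn_trans IHk (fi _ _ (ltnSn k)).
move=> A [N _ NA]; exists N => // k /= Nk; apply: NA => /=.
exact: leq_trans Nk (fge k).
Qed.

Lemma joint_bolzano_weierstrass (I : eqType) (u : nat -> I -> R) (s : seq I) :
  (forall i, exists C, forall k, `|u k i| <= C) ->
  exists2 f : nat -> nat, {homo f : i j / (i < j)%N} &
    forall i, i \in s -> cvgn (fun k => u (f k) i).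
Proof.
move=> bu; elim: s => [|i s [f fi fs]]; first by exists id.
have [|g /leqW_mono gi gs] := @bolzano_weierstrass R (fun k => u (f k) i).
  have [C uC] := bu i; exists C; split; first exact: num_real.
  by move=> x Cx k _ /=; rewrite (le_trans (uC _)) // ltW.
have gi' : {homo g : i j / (i < j)%N} by move=> x y; rewrite gi.
exists (f \o g) => [x y xy|j]; first exact/fi/gi'.
rewrite inE => /predU1P[->//|/fs /cvg_ex[l fl]].
apply/cvg_ex; exists l; exact: (cvg_comp _ _ (increasing_seq_cvgy gi') fl).
Qed.

Lemma cvg_mx m n (T : Type) (F : set_system T) {FF : Filter F}
    (S : T -> 'M[R]_(m, n)) (L : 'M[R]_(m, n)) :
  (forall i j, S t i j @[t --> F] --> L i j) -> S t @[t --> F] --> L.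
Proof.
move=> SL A [P LP PA].
suff : \forall t \near F, forall i j, P i j (S t i j) by apply: filterS => t; exact: PA.
apply: filter_forall => i; apply: filter_forall => j.
exact: SL (LP i j).
Qed.

End finite_dimension.

(** * Convergence of the regularized minimizers *)

Section tikhonov.
Context {R : realType}.

Lemma frobenius_ge0 m N (A : 'M[R[i]]_(m, N)) : 0 <= frobenius A.
Proof. exact: sqrtr_ge0. Qed.

Lemma entry_le_frobenius m N (A : 'M[R[i]]_(m, N)) i j :
  `|complex.Re (A i j)| <= frobenius A /\ `|complex.Im (A i j)| <= frobenius A.
Proof.
have le : Normc.normc (A i j) ^+ 2 <= \sum_i \sum_j Normc.normc (A i j) ^+ 2.
  rewrite (bigD1 i) //= (bigD1 j) //= -addrA lerDl addr_ge0 ?sumr_ge0 // => k _.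
    by rewrite sqr_ge0.
  by rewrite sumr_ge0 // => l _; rewrite sqr_ge0.
move: le; case: (A i j) => a b /=; rewrite sqr_sqrtr ?addr_ge0 ?sqr_ge0 // => le.
rewrite /frobenius -!sqrtr_sqr; split; apply: ler_wsqrtr; apply: le_trans le.
  by rewrite lerDl sqr_ge0.
by rewrite lerDr sqr_ge0.
Qed.

Lemma lq_pow_ge0 k (q : R) (x : 'cV[R]_k) : 0 <= lq_pow q x.
Proof. by apply: sumr_ge0 => i _; exact: powR_ge0. Qed.

Lemma entry_le_lq_pow k (q c : R) (x : 'cV[R]_k) i : 0 < q ->
  lq_pow q x <= c -> `|x i 0| <= c `^ q^-1.
Proof.
move=> q0 xc; have xi : `|x i 0| `^ q <= c.
  apply: le_trans xc; rewrite /lq_pow (bigD1 i) //= lerDl.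
  by apply: sumr_ge0 => j _; exact: powR_ge0.
have -> : `|x i 0| = (`|x i 0| `^ q) `^ q^-1.
  by rewrite -powRrM mulfV ?gt_eqF // powRr1.
by apply: ge0_ler_powR; rewrite ?nnegrE ?powR_ge0 ?invr_ge0 ?(ltW q0) // (le_trans _ xi) ?powR_ge0.
Qed.

Lemma vecE n N (S : 'M[R]_(n, N)) i j : vec S (mxtens_index (j, i)) 0 = S i j.
Proof. by rewrite mxE mxtens_indexK. Qed.

(** Coercivity of the penalty: the Laplacian being invertible, its sublevel sets
    are bounded. *)
Lemma entry_le_laplacian n N (q c : R) : 0 < q ->
  forall ij : 'I_n * 'I_N, exists C, forall S : 'M[R]_(n, N),
    lq_pow q (laplacian S) <= c -> `|S ij.1 ij.2| <= C.
Proof.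
move=> q0 [i j] /=; pose k := mxtens_index (j, i).
exists (\sum_l `|invmx (laplacian_mx n N) k l| * c `^ q^-1) => S Sc.
rewrite -vecE -[vec S](mulKmx (laplacian_mx_unit n N)) mxE.
apply: le_trans (ler_norm_sum _ _ _) _; apply: ler_sum => l _.
by rewrite normrM ler_wpM2l // entry_le_lq_pow.
Qed.

Lemma lq_pow_laplacian_cvg n N (q : R) (S_ : nat -> 'M[R]_(n, N)) (S : 'M[R]_(n, N)) :
  0 < q -> (forall i j, S_ k i j @[k --> \oo] --> S i j) ->
  lq_pow q (laplacian (S_ k)) @[k --> \oo] --> lq_pow q (laplacian S).
Proof.
move=> q0 SS; apply: cvg_big => [|l _]; [exact: add_continuous | apply: powR_norm_cvg => //].
rewrite mxE; under eq_fun do rewrite mxE.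
apply: cvg_big => [|l' _]; [exact: add_continuous | apply: cvgM; first exact: cvg_cst].
by rewrite mxE; under eq_fun do rewrite mxE; exact: SS.
Qed.

(** Comparison with a competitor in the cone has a finite value on the right, so a
    minimizer has no infinite indicator. *)
Lemma objective_min_ineq n N m (M : 'M[R]_(n, N) -> 'M[R[i]]_(m, N)) (q g : R) B
    (S T : 'M[R]_(n, N)) :
  argmin setT (objective M q g B) S -> T \is a mxOver Num.nneg ->
  S \is a mxOver Num.nneg /\
  2^-1 * frobenius (M S - B) ^+ 2 + g / q * lq_pow q (laplacian S) <=
  2^-1 * frobenius (M T - B) ^+ 2 + g / q * lq_pow q (laplacian T).
Proof.
move=> [_ /(_ T I)]; rewrite /objective /iota0 => + T0; rewrite T0 adde0.
by case: ifP => [S0|_]; [rewrite adde0 lee_fin | rewrite addey].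
Qed.

(** The classical argument for Tikhonov regularization, for any forward operator
    that is sequentially continuous on the non-negative cone. *)
Theorem tikhonov_stability n N m (M : 'M[R]_(n, N) -> 'M[R[i]]_(m, N)) (q : R)
    (B : 'M[R[i]]_(m, N)) (Bdelta : nat -> 'M[R[i]]_(m, N))
    (delta gamma : nat -> R) (Sigma : nat -> 'M[R]_(n, N)) :
  (forall (S_ : nat -> 'M[R]_(n, N)) (S : 'M[R]_(n, N)),
    (forall k, S_ k \is a mxOver Num.nneg) -> S \is a mxOver Num.nneg ->
    (forall i j, S_ k i j @[k --> \oo] --> S i j) ->
    forall i j, ccvg \oo (fun k => M (S_ k) i j) (M S i j)) ->
  0 < q ->
  (forall j, frobenius (B - Bdelta j) <= delta j) ->
  delta @ \oo --> (0 : R) ->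
  (forall j, 0 < gamma j) ->
  gamma @ \oo --> (0 : R) ->
  (fun j => delta j ^+ 2 / gamma j) @ \oo --> (0 : R) ->
  (forall j, argmin setT (objective M q (gamma j) (Bdelta j)) (Sigma j)) ->
  exact_solutions M q B !=set0 ->
  exists (k : nat -> nat) (Sigmastar : 'M[R]_(n, N)),
    [/\ {homo k : i j / (i < j)%N},
        (fun i => Sigma (k i)) @ \oo --> Sigmastar &
        exact_solutions M q B Sigmastar].
Proof.
move=> Mcont q0 noise delta0 gamma_gt0 gamma0 ratio0 Smin [T [[MT T0] Tmin]].
have delta_ge0 j : 0 <= delta j by apply: le_trans (noise j); exact: frobenius_ge0.
set L := lq_pow q (laplacian T).
have L0 : 0 <= L by exact: lq_pow_ge0.
(* Sigma_j is compared with the exact solution T, whose misfit is at most delta_j;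
   each of the two non-negative terms on the left is bounded by the right. *)
have ineq j : [/\ Sigma j \is a mxOver Num.nneg,
    lq_pow q (laplacian (Sigma j)) <= q / 2 * (delta j ^+ 2 / gamma j) + L &
    frobenius (M (Sigma j) - Bdelta j) ^+ 2 <= delta j ^+ 2 + 2 / q * L * gamma j].
  have [S0 le] := objective_min_ineq (Smin j) T0.
  have nj : frobenius (M T - Bdelta j) ^+ 2 <= delta j ^+ 2.
    by rewrite MT ler_sqr ?nnegrE ?frobenius_ge0.
  have gq : 0 < gamma j / q by rewrite divr_gt0.
  rewrite -/L in le; split => //.
    rewrite -(ler_pM2l gq) mulrDr.
    have -> : gamma j / q * (q / 2 * (delta j ^+ 2 / gamma j)) = 2^-1 * delta j ^+ 2.
      by field; rewrite !gt_eqF.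
    have := sqr_ge0 (frobenius (M (Sigma j) - Bdelta j)); lra.
  have -> : 2 / q * L * gamma j = 2 * (gamma j / q * L) by ring.
  have := mulr_ge0 (ltW gq) (lq_pow_ge0 q (laplacian (Sigma j))); lra.
have [K ratioK] : exists K, forall j, delta j ^+ 2 / gamma j <= K.
  have /cvg_seq_bounded[K [_ Kle]] : cvgn (fun j => delta j ^+ 2 / gamma j).
    by apply/cvg_ex; exists 0.
  by exists (K + 1) => j; apply: le_trans (ler_norm _) (Kle _ _ j I); rewrite ltrDl.
have [f fi /= Scvg] : exists2 f : nat -> nat, {homo f : i j / (i < j)%N} &
    forall ij : 'I_n * 'I_N, ij \in enum {: 'I_n * 'I_N} ->
      cvgn (fun k => Sigma (f k) ij.1 ij.2).
  apply: (joint_bolzano_weierstrass (u := fun k ij => Sigma k ij.1 ij.2)) => ij.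
  have [C SC] := entry_le_laplacian (q / 2 * K + L) q0 ij.
  exists C => k; apply: SC; have [_ le _] := ineq k; apply: le_trans le _.
  by rewrite lerD2r ler_wpM2l // divr_ge0 // ltW.
have foo := increasing_seq_cvgy fi.
pose S : 'M[R]_(n, N) := \matrix_(i, j) limn (fun k => Sigma (f k) i j).
have Sl i j : Sigma (f k) i j @[k --> \oo] --> S i j.
  by rewrite mxE; apply: (Scvg (i, j)); rewrite mem_enum.
have S0 : S \is a mxOver Num.nneg.
  apply/mxOverP => i j; rewrite nnegrE.
  apply: (ler_cvg_to (cvg_cst 0) (Sl i j)); apply: nearW => k.
  by have [/mxOverP/(_ i j)] := ineq (f k).
(* This quantity bounds the distance from M (Sigma_(f k)) to B: it is the bound on
   the misfit to B^delta plus the noise level. *)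
have e0 : Num.sqrt (delta (f k) ^+ 2 + 2 / q * L * gamma (f k)) + delta (f k)
    @[k --> \oo] --> (0 : R).
  have df := cvg_comp _ _ foo delta0; have gf := cvg_comp _ _ foo gamma0.
  suff : Num.sqrt (delta (f k) ^+ 2 + 2 / q * L * gamma (f k)) + delta (f k)
      @[k --> \oo] --> Num.sqrt (0 * 0 + 2 / q * L * 0) + 0.
    by rewrite !mulr0 !addr0 sqrtr0.
  apply: cvgD => //.
  apply: (@continuous_cvg _ _ _ _ _ _ Num.sqrt); first exact: sqrt_continuous.
  by apply: cvgD; apply: cvgM => //; exact: cvg_cst.
have close k i j : let z := M (Sigma (f k)) i j in
  `|complex.Re z - complex.Re (B i j)| <=
    Num.sqrt (delta (f k) ^+ 2 + 2 / q * L * gamma (f k)) + delta (f k) /\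
  `|complex.Im z - complex.Im (B i j)| <=
    Num.sqrt (delta (f k) ^+ 2 + 2 / q * L * gamma (f k)) + delta (f k).
  have [_ _ le] := ineq (f k).
  have {}le : frobenius (M (Sigma (f k)) - Bdelta (f k)) <=
      Num.sqrt (delta (f k) ^+ 2 + 2 / q * L * gamma (f k)).
    by rewrite -[leLHS]ger0_norm ?frobenius_ge0 // -sqrtr_sqr ler_wsqrtr.
  have [r1 i1] := entry_le_frobenius (M (Sigma (f k)) - Bdelta (f k)) i j.
  have [r2 i2] := entry_le_frobenius (B - Bdelta (f k)) i j.
  have nk := noise (f k).
  have ReB (x y : R[i]) : complex.Re (x - y) = complex.Re x - complex.Re y.
    by case: x y => [? ?] [? ?].
  have ImB (x y : R[i]) : complex.Im (x - y) = complex.Im x - complex.Im y.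
    by case: x y => [? ?] [? ?].
  move: r1 i1 r2 i2; rewrite !mxE !ReB !ImB => r1 i1 r2 i2; split.
    rewrite (le_trans (ler_distD (complex.Re (Bdelta (f k) i j)) _ _)) //.
    by rewrite lerD ?(le_trans r1) // distrC (le_trans r2).
  rewrite (le_trans (ler_distD (complex.Im (Bdelta (f k) i j)) _ _)) //.
  by rewrite lerD ?(le_trans i1) // distrC (le_trans i2).
have MS : M S = B.
  apply/matrixP => i j.
  have [|Re_l Im_l] := Mcont (fun k => Sigma (f k)) S _ S0 Sl i j.
    by move=> k; have [] := ineq (f k).
  apply/eqP; rewrite eq_complex -subr_eq0 -[X in _ && X]subr_eq0 -!normr_le0.
  apply/andP; split.
    apply: (ler_cvg_to (cvg_norm (cvgB Re_l (cvg_cst (complex.Re (B i j))))) e0).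
    by apply: nearW => k; have [] := close k i j.
  apply: (ler_cvg_to (cvg_norm (cvgB Im_l (cvg_cst (complex.Im (B i j))))) e0).
  by apply: nearW => k; have [] := close k i j.
exists f, S; split; [exact: fi | exact: cvg_mx | split; first by split].
move=> Y HY; apply: le_trans (Tmin Y HY).
have rf : q / 2 * (delta (f k) ^+ 2 / gamma (f k)) + L @[k --> \oo] --> L.
  suff : q / 2 * (delta (f k) ^+ 2 / gamma (f k)) + L @[k --> \oo] --> q / 2 * 0 + L.
    by rewrite mulr0 add0r.
  apply: cvgD; last exact: cvg_cst.
  by apply: cvgM; [exact: cvg_cst | exact: (cvg_comp _ _ foo ratio0)].
apply: (ler_cvg_to (lq_pow_laplacian_cvg q0 Sl) rf).
by apply: nearW => k; have [] := ineq (f k).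
Qed.

End tikhonov.

Theorem theorem1 (R : realType) (n N mrho mh momega : nat) (d : 'I_n -> R)
    (rho : 'I_mrho -> R) (h : 'I_mh -> R) (omega : 'I_momega -> R)
    (e : 'I_(2 * mrho * mh * momega) -> 'I_2 * 'I_mrho * 'I_mh * 'I_momega)
    (q : R) (B : 'M[complex R]_(2 * mrho * mh * momega, N))
    (Bdelta : nat -> 'M[complex R]_(2 * mrho * mh * momega, N))
    (delta gamma : nat -> R) (Sigma : nat -> 'M[R]_(n.+1, N))
    (d_gt0 : forall i, 0 < d i) (rho_gt0 : forall t, 0 < rho t)
    (h_gt0 : forall l, 0 < h l) (omega_gt0 : forall s, 0 < omega s)
    (e_bij : bijective e)
    (q_gt0 : 0 < q) (q_le2 : q <= 2)
    (B_noise : forall j, frobenius (B - Bdelta j) <= delta j)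
    (delta_cvg : delta @ \oo --> (0 : R))
    (gamma_gt0 : forall j, 0 < gamma j)
    (gamma_cvg : gamma @ \oo --> (0 : R))
    (ratio_cvg : (fun j => delta j ^+ 2 / gamma j) @ \oo --> (0 : R))
    (Sigma_min : forall j,
      argmin setT (objective (forward d rho h omega e) q (gamma j) (Bdelta j))
             (Sigma j))
    (sol_neq0 : exact_solutions (forward d rho h omega e) q B !=set0) :
  exists (k : nat -> nat) (Sigmastar : 'M[R]_(n.+1, N)),
    [/\ {homo k : i j / (i < j)%N},
        (fun i => Sigma (k i)) @ \oo --> Sigmastar &
        exact_solutions (forward d rho h omega e) q B Sigmastar].
Proof.
apply: (tikhonov_stability (delta := delta) (gamma := gamma)) Sigma_min sol_neq0 => //.
move=> S_ S S_0 S0 Sl k j; rewrite mxE; under eq_fun do rewrite mxE.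
case: (e k) => [[[nu t] l] s].
apply: fdem_cvg => // [k' i|i]; first by have /mxOverP := S_0 k'; exact.
by have /mxOverP := S0; exact.
Qed.
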